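(* Let $H$ be a graph containing a cycle $C$ and three vertices none of which has a neighbor in $V(C)$. Then the class of $H$-subdivisions does not have the induced Erdős–Pósa property.
   Context: All graphs are finite and simple. A subdivision of $H$ is a graph obtained from $H$ by repeatedly replacing an edge by a path of length $2$ through a new vertex. An induced subdivision of $H$ in $G$ is an induced subgraph of $G$ isomorphic to a subdivision of $H$. The class of $H$-subdivisions has the induced Erdős–Pósa property if there is a function $f:\mathbb N\to\mathbb R$ such that for every graph $G$ and every positive integer $k$, $G$ contains either $k$ pairwise vertex-disjoint induced subdivisions of $H$ or a set of at most $f(k)$ vertices meeting every induced subdivision of $H$. *)

(* Defs.v *)
From mathcomp Require Import all_boot.
Set Implicit Arguments. Unset Strict Implicit. Unset Printing Implicit Defensive.

Definition graph_iso (T1 T2 : finType) (e1 : rel T1) (e2 : rel T2) : Prop :=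
  exists g : T1 -> T2, bijective g /\ forall x y, e1 x y = e2 (g x) (g y).

(* The graph obtained from (T, e) by replacing the edge ab by a path a - new - b;
   the new vertex is [None]. *)
Definition subdivide_edge (T : finType) (e : rel T) (a b : T) : rel (option T) :=
  fun x y =>
    match x, y with
    | Some u, Some v => e u v && ~~ (((u == a) && (v == b)) || ((u == b) && (v == a)))
    | None, Some v => (v == a) || (v == b)
    | Some u, None => (u == a) || (u == b)
    | None, None => false
    end.

Inductive subdivision (T : finType) (e : rel T) : forall (S : finType), rel S -> Prop :=
| subdiv_refl (S : finType) (f : rel S) : graph_iso e f -> subdivision e f
| subdiv_step (S : finType) (f : rel S) (a b : S) (S2 : finType) (f2 : rel S2) :
    subdivision e f -> f a b -> graph_iso (subdivide_edge f a b) f2 ->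
    subdivision e f2.

Definition induced (V : finType) (e : rel V) (A : {set V}) : rel {x : V | x \in A} :=
  fun x y => e (val x) (val y).

Definition induced_subdiv (TH : finType) (eH : rel TH) (V : finType) (e : rel V)
  (A : {set V}) : Prop := subdivision eH (@induced V e A).

Definition is_graph (T : finType) (e : rel T) : Prop := symmetric e /\ irreflexive e.

Definition induced_EP (TH : finType) (eH : rel TH) : Prop :=
  exists f : nat -> nat,
    forall (V : finType) (e : rel V), is_graph e ->
    forall k : nat, 0 < k ->
      (exists P : 'I_k -> {set V},
          (forall i, induced_subdiv eH e (P i)) /\
          (forall i j, i != j -> [disjoint P i & P j]))
      \/
      (exists X : {set V}, #|X| <= f k /\
          forall A : {set V}, induced_subdiv eH e A -> ~~ [disjoint A & X]).

(* Main.v *)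
Require Import Defs.
From mathcomp Require Import all_boot.
From Stdlib Require Import Classical.
Set Implicit Arguments. Unset Strict Implicit. Unset Printing Implicit Defensive.

(* Let K be a subdivision of H of large girth, with no proper induced subgraph
   that is a subdivision of H, and choose distinct vertices l(1), ..., l(n) on a
   cycle of K.  Glue n copies of K by identifying l(j) of copy i with l(i) of
   copy j, and join any two vertices that lie in no common copy.  Then any two
   copies meet while each vertex is in at most two copies, so hitting all copies
   takes n/2 vertices.  It remains to see that the induced subdivisions of H are
   exactly the copies.  Non-adjacent vertices share a copy, and two vertices
   share at most one copy; a family of at least three vertices cross-intersecting
   in this sense with three further vertices u, v, w lies in one copy.  Hence the
   cycle far from u, v, w lies in one copy, and is long by the girth condition.  A
   vertex outside that copy is adjacent to all but two vertices of the cycle, too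
   many for a subdivision of H.  So the subdivision lies in the copy and, by
   minimality of K, equals it. *)

(** * Isomorphisms and induced subgraphs *)

Lemma graph_iso_refl (T : finType) (e : rel T) : graph_iso e e.
Proof. by exists id; split => //; exists id. Qed.

Lemma graph_iso_trans (T1 T2 T3 : finType) (e1 : rel T1) (e2 : rel T2) (e3 : rel T3) :
  graph_iso e1 e2 -> graph_iso e2 e3 -> graph_iso e1 e3.
Proof.
move=> [g [bg Eg]] [h [bh Eh]]; exists (h \o g); split; first exact: bij_comp.
by move=> x y; rewrite Eg Eh.
Qed.

Lemma graph_iso_sym (T1 T2 : finType) (e1 : rel T1) (e2 : rel T2) :
  graph_iso e1 e2 -> graph_iso e2 e1.
Proof.
move=> [g [[h gK hK] Eg]]; exists h; split; first by exists g.
by move=> x y; rewrite Eg !hK.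
Qed.

Lemma subdivision_iso (T S S' : finType) (e : rel T) (f : rel S) (f' : rel S') :
  subdivision e f -> graph_iso f f' -> subdivision e f'.
Proof.
case=> [{}S {}f ef|{}S {}f a b S2 f2 ef fab ff2] iso.
  exact: subdiv_refl (graph_iso_trans ef iso).
exact: subdiv_step ef fab (graph_iso_trans ff2 iso).
Qed.

Lemma induced_iso (T V : finType) (f : rel T) (e : rel V) (g : T -> V)
    (B : {set T}) (A : {set V}) :
  injective g -> (forall x y, f x y = e (g x) (g y)) -> A = g @: B ->
  graph_iso (@induced T f B) (@induced V e A).
Proof.
move=> inj_g Eg defA.
have gA (x : {x | x \in B}) : g (val x) \in A by rewrite defA imset_f ?(valP x).
exists (fun x => exist (fun y => y \in A) (g (val x)) (gA x)); split; last first.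
  by move=> x y; rewrite /induced /= Eg.
apply: inj_card_bij; first by move=> x y /(congr1 val) /= /inj_g /val_inj.
by rewrite !card_sig defA card_imset.
Qed.

Lemma induced_setT_iso (T : finType) (f : rel T) : graph_iso f (@induced T f setT).
Proof.
exists (fun x => exist (fun y => y \in setT) x (in_setT x)); split=> //.
by exists val => // x; apply: val_inj.
Qed.

(** * Cycles and degrees *)

Definition is_cycle (T : eqType) (e : rel T) (c : seq T) : bool :=
  [&& uniq c, 2 < size c & cycle e c].

Definition max_degree_le (T : finType) (e : rel T) (d : nat) : Prop :=
  forall x, #|[set y | e x y]| <= d.

(** The property of [H] that all its subdivisions inherit. Disjointness from the cycle is recorded
    because the gluing argument needs three points outside the family. *)
Definition far_cycle (T : finType) (e : rel T) : Prop :=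
  exists c u v w,
    [/\ is_cycle e c, [&& u != v, u != w & v != w]
      & forall z, z \in [:: u; v; w] -> forall x, x \in c -> (x != z) && ~~ e z x].

Lemma is_cycle_map (T T' : eqType) (e : rel T) (e' : rel T') (g : T -> T') (c : seq T) :
  injective g -> (forall x y, e x y = e' (g x) (g y)) ->
  is_cycle e' (map g c) = is_cycle e c.
Proof.
move=> inj_g Eg; rewrite /is_cycle (map_inj_uniq inj_g) size_map cycle_map.
by congr [&& _, _ & _]; apply: eq_cycle => x y; rewrite /= -Eg.
Qed.

Lemma seq_option_map (T : eqType) (s : seq (option T)) : None \notin s -> s = map Some (pmap id s).
Proof. by elim: s => [|[x|] s IH] //=; rewrite inE /= => /IH <-. Qed.

(** * Subdividing a single edge *)

Section SubdivideEdge.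

Variables (S : finType) (f : rel S) (a b : S).
Hypotheses (fG : is_graph f) (fab : f a b).
Notation f' := (subdivide_edge f a b).

Lemma subdivide_edge_graph : is_graph f'.
Proof.
case: fG => fsym firr; split.
  move=> [x|] [y|] //=; rewrite fsym; congr (_ && ~~ _).
  by rewrite orbC [X in _ || X]andbC [X in X || _]andbC.
by move=> [x|] //=; rewrite firr.
Qed.

(** The new vertex has degree 2, an end of the edge trades one neighbour for it, and any other
    vertex keeps its neighbours. *)
Lemma subdivide_edge_degree d :
  1 < d -> max_degree_le f d -> max_degree_le f' d.
Proof.
case: fG => fsym firr d1 fd [x|]; last first.
  apply: leq_trans d1.
  have -> : [set y | f' None y] = [set Some a; Some b].
    by apply/setP => -[y|]; rewrite !inE.
  by rewrite cards2; case: (_ == _).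
have inj_S : injective (@Some S) by move=> ? ? [].
have gen y : f x y -> [set z | f' (Some x) z] \subset None |: (Some @: ([set z | f x z] :\ y)) ->
    #|[set z | f' (Some x) z]| <= d.
  move=> fxy /subset_leq_card le; apply: leq_trans le _.
  apply: leq_trans (fd x); rewrite (cardsD1 y [set z | f x z]) inE fxy.
  by rewrite cardsU1 (card_imset _ inj_S) leq_add // leq_b1.
have [xa|xa] := eqVneq x a.
  apply: (gen b); first by rewrite xa.
  apply/subsetP => -[z|]; rewrite !inE //= xa eqxx /= => /andP[faz].
  by rewrite negb_or => /andP[zb _]; rewrite mem_imset // !inE zb.
have [xb|xb] := eqVneq x b.
  apply: (gen a); first by rewrite xb fsym.
  apply/subsetP => -[z|]; rewrite !inE //= xb eqxx /= => /andP[faz].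
  by rewrite negb_or => /andP[_ zb]; rewrite mem_imset // !inE zb.
apply: leq_trans (fd x); rewrite -(card_imset _ inj_S); apply/subset_leq_card/subsetP.
move=> [z|]; rewrite !inE /= ?(negPf xa) ?(negPf xb) // => /andP[fxz _].
by rewrite mem_imset // inE.
Qed.

(** A cycle through the edge [ab] is rerouted through the new vertex; any other survives. The last
    two clauses keep far vertices far. *)
Lemma subdivide_edge_expand c :
  is_cycle f c ->
  exists c', [/\ is_cycle f' c', forall x, Some x \in c' -> x \in c
               & None \in c' -> (a \in c) && (b \in c)].
Proof.
case: fG => fsym firr /and3P[Uc c2 cc].
have inj_S : injective (@Some S) by move=> ? ? [].
pose g x y := f' (Some x) (Some y).
have [gc|/negP ngc] := boolP (cycle g c).
  exists (map Some c); split.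
  - by rewrite (@is_cycle_map _ _ g) // /is_cycle Uc c2.
  - by move=> x; rewrite mem_map.
  - by case/mapP.
have [x xc ngx] : exists2 x, x \in c & ~~ g x (next c x).
  apply/hasP; apply: contraT => /hasPn h; case: ngc.
  by apply: cycle_from_next => // x xc; rewrite -[g _ _]negbK; apply: h.
have fx := next_cycle cc xc.
have yc : next c x \in c by rewrite mem_next.
have xy : ((x == a) && (next c x == b)) || ((x == b) && (next c x == a)).
  by move: ngx; rewrite /g /= fx /= negbK.
have abc : (a \in c) && (b \in c).
  by case/orP: xy => /andP[/eqP <- /eqP <-]; rewrite xc yc.
(* Start the cycle at the lost edge [x y]. A third vertex [z] exists, so no other edge of the cycle
   is [ab]. *)
case: (rot_to xc) => i p rp.
have Ur : uniq (x :: p) by rewrite -rp rot_uniq.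
have sr : size (x :: p) = size c by rewrite -rp size_rot.
have mr : x :: p =i c by move=> z; rewrite -rp mem_rot.
have cr : cycle f (x :: p) by rewrite -rp rot_cycle.
have ny : next c x = next (x :: p) x by rewrite -rp next_rot.
case: p rp Ur sr mr cr ny => [|y p] rp Ur sr mr cr; first by rewrite -sr in c2.
rewrite /= eqxx => ny; rewrite ny in xy.
case: p {rp} Ur sr mr cr => [|z p] Ur sr mr cr; first by rewrite -sr in c2.
move: Ur => /= /and3P[]; rewrite !inE !negb_or.
move=> /and3P[nxy nxz nxp] /andP[nyz nyp] Uzp.
move: cr => /= /and3P[fxy fyz pz].
have fEx t1 t2 : t1 != y -> t2 != y -> f t1 t2 -> f' (Some t1) (Some t2).
  move=> n1 n2 h; rewrite /= h /=.
  by case/orP: xy => /andP[/eqP <- /eqP <-]; rewrite (negPf n1) (negPf n2) ?andbF.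
have gyz : g y z.
  rewrite /g /= fyz /=; case/orP: xy => /andP[/eqP <- /eqP <-];
    by rewrite ![_ == x]eq_sym (negPf nxy) (negPf nxz) andbF.
have gz : path g z (rcons p x).
  apply: (@sub_in_path _ (predC1 y) f) pz; last first.
    rewrite -rcons_cons all_rcons /= nxy eq_sym nyz /=.
    by apply/allP => t tp; apply: contra nyp => /eqP <-.
  by move=> t1 t2 h1 h2 h; apply: fEx.
have mem_c' t : (Some t \in [:: Some y, Some z & map Some (rcons p x)]) = (t \in c).
  rewrite -mr -[_ :: _ :: _]/(map Some [:: y, z & rcons p x]) mem_map // !inE mem_rcons.
  by rewrite inE; do 3!case: (t == _).
exists [:: None, Some y, Some z & map Some (rcons p x)]; split=> //.
- rewrite /is_cycle; apply/and3P; split=> //; last first.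
    rewrite -[cycle _ _]/[&& f' None (Some y), g y z &
      path f' (Some z) (rcons (map Some (rcons p x)) None)].
    rewrite gyz rcons_path path_map (eq_path (e' := g)) // gz last_map last_rcons /=.
    by case/orP: xy => /andP[/eqP -> /eqP ->]; rewrite !eqxx ?orbT.
  rewrite cons_uniq; apply/andP; split.
    by rewrite !inE; apply/mapP => -[].
  rewrite -[_ :: _ :: _]/(map Some [:: y, z & rcons p x]) map_inj_uniq // /= !inE !mem_rcons.
  rewrite !inE rcons_uniq !negb_or nyz nyp eq_sym nxy eq_sym nxz nxp.
  by move: Uzp.
- by move=> t; rewrite in_cons /= mem_c'.
Qed.

(** On a cycle the new vertex lies between [a] and [b], so bypassing it along [ab] gives a shorter
    cycle. *)
Lemma subdivide_edge_contract c :
  is_cycle f' c ->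
  (exists2 c', c = map Some c' & is_cycle f c') \/
  (exists2 c', size c' < size c & is_cycle f c').
Proof.
case: fG => fsym firr /and3P[Uc c2 cc].
have inj_S : injective (@Some S) by move=> ? ? [].
have sub : subrel (relpre Some f') f by move=> x y /= /andP[].
have [Nc|Nc] := boolP (None \in c); last first.
  have defc := seq_option_map Nc; left; exists (pmap id c) => //.
  move: Uc c2 cc; rewrite {1 2 3}defc map_inj_uniq // size_map cycle_map.
  by rewrite /is_cycle => -> -> /(sub_cycle sub).
right; case: (rot_to Nc) => i p rp.
move: Uc c2 cc; rewrite -(rot_uniq i) -(size_rot i) -(rot_cycle i) rp /=.
case/andP=> Np Up; move: Up; rewrite (seq_option_map Np).
case: (pmap id p) => [|x [|y q]] //; rewrite map_inj_uniq // => Uq _.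
rewrite [map Some _]/= [path _ _ _]/= !rcons_path last_map path_map => /and4P[xab hxy pq].
rewrite /= => lab.
have nxl : x != last y q.
  by apply: contraTneq Uq => ->; rewrite cons_uniq mem_last.
have xl : ((x == a) && (last y q == b)) || ((x == b) && (last y q == a)).
  by move: nxl; case/orP: xab => /eqP->; case/orP: lab => /eqP->; rewrite !eqxx ?orbT.
have flx : f (last y q) x.
  by case/orP: xl => /andP[/eqP-> /eqP->]; rewrite // fsym.
exists [:: x, y & q].
  by rewrite /= size_map.
apply/and3P; split=> //; last first.
  by rewrite /= rcons_path (sub_path sub) // (sub _ _ hxy).
(* With [q] empty, [x] and [y] would be [a] and [b], which are no longer adjacent. *)
by case: q {Uq pq lab nxl flx} xl hxy => //= ->; rewrite andbF.
Qed.

End SubdivideEdge.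

Lemma far_cycle_subdivide (S : finType) (f : rel S) (a b : S) :
  is_graph f -> far_cycle f -> far_cycle (subdivide_edge f a b).
Proof.
move=> fG [c [u [v [w [cc duvw far]]]]].
have [c' [cc' c'S c'N]] := subdivide_edge_expand a b fG cc.
exists c', (Some u), (Some v), (Some w); split=> // z' z'uvw.
have [z -> zuvw] : exists2 z, z' = Some z & z \in [:: u; v; w].
  by move: z'uvw; rewrite !inE => /or3P[] /eqP ->;
    [exists u | exists v | exists w]; rewrite ?inE ?eqxx ?orbT.
move=> [x|] xc' /=.
  have /andP[xz nzx] := far z zuvw x (c'S x xc').
  by rewrite (negPf nzx) andbT (inj_eq (@Some_inj _)).
(* The new vertex sees only [a] and [b], which lie on the old cycle and so differ from [z]. *)
have /andP[ac bc] := c'N xc'.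
have /andP[az _] := far z zuvw a ac; have /andP[bz _] := far z zuvw b bc.
by rewrite ![z == _]eq_sym negb_or az bz.
Qed.

(** * Invariance under isomorphism *)

Section IsoInvariance.

Variables (S S' : finType) (f : rel S) (f' : rel S').
Hypothesis iso : graph_iso f f'.

Lemma graph_iso_graph : is_graph f -> is_graph f'.
Proof.
have [g [_ Eg]] := graph_iso_sym iso.
by move=> [fsym firr]; split=> [x y|x]; rewrite !Eg // fsym.
Qed.

Lemma graph_iso_degree d : max_degree_le f d -> max_degree_le f' d.
Proof.
have [g [/bij_inj inj_g Eg]] := graph_iso_sym iso.
move=> fd x; apply: leq_trans (fd (g x)); rewrite -(card_imset _ inj_g).
apply/subset_leq_card/subsetP => z /imsetP[y]; rewrite inE => xy ->.
by rewrite inE -Eg.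
Qed.

Lemma graph_iso_far_cycle : far_cycle f -> far_cycle f'.
Proof.
have [g [/bij_inj inj_g Eg]] := iso.
move=> [c [u [v [w [cc duvw far]]]]]; exists (map g c), (g u), (g v), (g w); split.
- by rewrite (is_cycle_map c inj_g Eg).
- by rewrite !(inj_eq inj_g).
move=> z' z'uvw _ /mapP[x xc ->].
have /mapP[z zuvw ->] : z' \in map g [:: u; v; w] by [].
by rewrite (inj_eq inj_g) -Eg; apply: far.
Qed.

End IsoInvariance.

(** * Degree, far cycles and girth of subdivisions *)

Section SubdivisionInvariants.

Variables (T : finType) (e : rel T).

Lemma subdivision_graph (S : finType) (f : rel S) :
  is_graph e -> subdivision e f -> is_graph f.
Proof.
move=> eG; elim=> [{}S {}f|{}S {}f a b S2 f2 _ fG fab]; move/graph_iso_graph; apply=> //.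
exact: subdivide_edge_graph.
Qed.

Lemma subdivision_degree d (S : finType) (f : rel S) :
  is_graph e -> 1 < d -> max_degree_le e d -> subdivision e f -> max_degree_le f d.
Proof.
move=> eG d1 ed; elim=> [{}S {}f|{}S {}f a b S2 f2 ef fd fab]; move/graph_iso_degree; apply=> //.
exact: subdivide_edge_degree (subdivision_graph eG ef) _ _ _ _.
Qed.

Lemma subdivision_far_cycle (S : finType) (f : rel S) :
  is_graph e -> far_cycle e -> subdivision e f -> far_cycle f.
Proof.
move=> eG efar; elim=> [{}S {}f|{}S {}f a b S2 f2 ef ffar fab];
  move/graph_iso_far_cycle; apply=> //.
exact: far_cycle_subdivide (subdivision_graph eG ef) _.
Qed.

(* Subdividing an edge of a shortest cycle destroys that cycle and creates no
   new cycle of the same length. *)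
Lemma subdivision_girth_succ m (S : finType) (f : rel S) :
  is_graph e -> subdivision e f -> (forall c, is_cycle f c -> m <= size c) ->
  exists (S' : finType) (f' : rel S'),
    subdivision e f' /\ forall c, is_cycle f' c -> m < size c.
Proof.
move=> eG.
pose short (U : finType) (h : rel U) := [set t : m.-tuple U | is_cycle h t].
have [k le_k] := ubnP #|short S f|.
elim: k S f le_k => // k IH S f le_k ef girth.
have fG := subdivision_graph eG ef.
have [s0|[t]] := set_0Vmem (short S f).
  exists S, f; split=> // c cc; rewrite ltn_neqAle girth // andbT.
  apply: contra_eqN s0 => /eqP sc; apply/set0Pn.
  by exists (tcast (esym sc) (in_tuple c)); rewrite inE val_tcast.
rewrite inE => tt; have /and3P[Ut t2 ct] := tt.
have [a [b [p deft]]] : exists a b p, tval t = [:: a, b & p].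
  by case: (tval t) t2 => [|a [|b p]] //; exists a, b, p.
have fab : f a b by move: ct; rewrite deft /= => /andP[].
have ef' := subdiv_step ef fab (graph_iso_refl _).
apply: (IH _ (subdivide_edge f a b)) => //; last first.
  move=> c /(subdivide_edge_contract fG fab)[[c' -> cc']|[c' lt cc']].
    by rewrite size_map girth.
  exact: leq_trans (girth _ cc') (ltnW lt).
have inj_S : injective (fun s : m.-tuple S => map_tuple Some s).
  move=> s1 s2 /(congr1 val) /= /inj_map h.
  by apply: val_inj; apply: h => ? ? [].
rewrite -ltnS; apply: leq_trans le_k; rewrite ltnS (cardsD1 t) inE tt -(card_imset _ inj_S) ltnS.
apply/subset_leq_card/subsetP => s; rewrite inE => cs.
have := cs => /(subdivide_edge_contract fG fab)[[c' defs cc']|[c' lt cc']]; last first.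
  by have := leq_ltn_trans (girth _ cc') lt; rewrite size_tuple ltnn.
have sc' : size c' = m by rewrite -(size_tuple s) defs size_map.
have -> : s = map_tuple Some (tcast sc' (in_tuple c')).
  by apply: val_inj; rewrite [LHS]defs; congr map; rewrite val_tcast.
rewrite mem_imset // !inE val_tcast /= cc' andbT.
apply: contraTneq cs => /(congr1 (@tval _ _)); rewrite val_tcast /= deft => c'E.
by rewrite defs c'E /is_cycle /= !eqxx !andbF.
Qed.

Lemma subdivision_girth m :
  is_graph e -> exists (S : finType) (f : rel S),
    subdivision e f /\ forall c, is_cycle f c -> m <= size c.
Proof.
move=> eG; elim: m => [|m [S [f [ef girth]]]].
  by exists T, e; split=> //; apply: subdiv_refl; apply: graph_iso_refl.
exact: subdivision_girth_succ ef girth.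
Qed.

(** Passing to a proper induced subgraph that is still a subdivision creates no cycle, so descent on
    the number of vertices keeps the girth bound. *)
Lemma subdivision_girth_minimal m :
  is_graph e -> exists (S : finType) (f : rel S),
    [/\ subdivision e f, forall c, is_cycle f c -> m <= size c
      & forall B : {set S}, induced_subdiv e f B -> B = setT].
Proof.
move=> eG; have [S [f [ef girth]]] := subdivision_girth m eG.
have [k le_k] := ubnP #|S|; elim: k S f le_k ef girth => // k IH S f le_k ef girth.
have [min|] := classic (forall B : {set S}, induced_subdiv e f B -> B = setT).
  by exists S, f.
move=> /not_all_ex_not[B nB]; have [eB {}nB] := imply_to_and _ _ nB.
apply: (IH _ (@induced S f B)) => //.
  rewrite -ltnS; apply: leq_trans le_k; rewrite ltnS card_sig -(cardsT S); apply: proper_card.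
  by rewrite properT; apply/eqP.
by move=> c cc; rewrite -(size_map val) girth // (is_cycle_map c val_inj (e := induced f (A:=B))).
Qed.

End SubdivisionInvariants.

(** * Families cross-intersecting with three points *)

Section CrossIntersecting.

Variables (I V : finType) (m : I -> pred V).
(** A linear hypergraph with every point on at most two edges; the edges will be the copies of
    [K]. *)
Hypothesis m_le2 : forall x i j k, m i x -> m j x -> m k x -> [|| i == j, i == k | j == k].
Hypothesis m_inj : forall i j x y, i != j -> m i x -> m j x -> m i y -> m j y -> x = y.

Definition meets (x z : V) := [exists i, m i x && m i z].

(** The sets [i] and [j] are the only ones through [v], so [z] lies in one of them. If in [i], then
    [z] reaches [w] through the same set [g] as [x], and [i] and [g] share only one point, so
    [z = x]; the case of [j] is symmetric. *)
Lemma no_common_cross_pair (u v w x y z : V) (i j : I) :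
    (forall k, ~~ [&& m k u, m k v & m k w]) ->
    m i u -> m i v -> m i x -> meets x w -> x != v ->
    m j v -> m j w -> m j y -> meets y u -> y != v ->
    meets z u -> meets z v -> meets z w -> z \notin [:: u; v; w] ->
  z \in [:: x; y].
Proof.
move=> nc iu iv ix /existsP[g /andP[gx gw]] xv jv jw jy /existsP[h /andP[hy hu]] yv.
move=> /existsP[p /andP[pz pu]] /existsP[q /andP[qz qv]] /existsP[r /andP[rz rw]].
rewrite !inE !negb_or => /and3P[_ zv _].
have niw : ~~ m i w by have := nc i; rewrite iu iv.
have nju : ~~ m j u by have := nc j; rewrite jv jw !andbT.
have ij : i != j by apply: contraNneq niw => ->.
have ig : i != g by apply: contraNneq niw => ->.
have jh : j != h by apply: contraNneq nju => ->.
have gj : g != j.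
  by apply: contraNneq xv => gj; subst; apply/eqP; apply: (m_inj ij).
have hi : h != i.
  by apply: contraNneq yv => hi; subst; apply/eqP; apply: (m_inj ij).
have iNz : m i z -> z = x.
  move=> iz; have rj : r != j.
    by apply: contraNneq zv => rj; subst; apply/eqP; apply: (m_inj ij).
  have := m_le2 gw rw jw; rewrite (negPf gj) (negPf rj) !orbF => /eqP gr.
  by apply: (m_inj ig) => //; rewrite gr.
have jNz : m j z -> z = y.
  move=> jz; have pi : p != i.
    by apply: contraNneq zv => pi; subst; apply/eqP; apply: (m_inj ij).
  have := m_le2 hu pu iu; rewrite (negPf hi) (negPf pi) !orbF => /eqP hp.
  by apply: (m_inj jh) => //; rewrite hp.
have := m_le2 iv jv qv; rewrite (negPf ij) /= => /orP[] /eqP eq_q.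
  by rewrite iNz ?eqxx // eq_q.
by rewrite jNz ?eqxx ?orbT // eq_q.
Qed.

(** For [y] in [c] outside [i], two of the sets joining it to [u], [v], [w] coincide. That set
    cannot hold both [u] and [v], else it would be [i]; so it holds [w] and one of them, which
    confines [c] to [x] and [y]. *)
Lemma cross_pair (u v w : V) (c : seq V) :
    (forall k, ~~ [&& m k u, m k v & m k w]) -> u != v ->
    uniq c -> 2 < size c ->
    (forall x, x \in c -> [&& x \notin [:: u; v; w], meets x u, meets x v & meets x w]) ->
    (exists x i, [/\ x \in c, m i x, m i u & m i v]) ->
  exists i, forall x, x \in c -> m i x.
Proof.
move=> nc uv Uc c2 cP [x [i [xc ix iu iv]]]; exists i => y yc.
apply: contraLR c2 => niy; rewrite -leqNgt -[2]/(size [:: x; y]).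
apply: uniq_leq_size => // z zc.
have /and4P[nx xu xv xw] := cP x xc; have /and4P[ny yu yv yw] := cP y yc.
have /and4P[nz zu zv zw] := cP z zc.
have [nxu nxv] : x != u /\ x != v by move: nx; rewrite !inE !negb_or => /and3P[].
have [nyu nyv] : y != u /\ y != v by move: ny; rewrite !inE !negb_or => /and3P[].
have niyE k : m k y -> m k u -> m k v -> False.
  by move=> ky ku kv; case/eqP: uv; apply: (@m_inj i k) => //; apply: contraNneq niy => ->.
have /existsP[p /andP[py pu]] := yu; have /existsP[q /andP[qy qv]] := yv.
have /existsP[r /andP[ry rw]] := yw.
case/or3P: (m_le2 py qy ry) => /eqP E; subst.
- by case: (niyE _ qy).
- apply: (@no_common_cross_pair v u w x y z i r) => //.
    by move=> k; rewrite andbCA.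
  by move: nz; rewrite !inE orbCA.
- exact: (@no_common_cross_pair u v w x y z i r).
Qed.

(** Only two sets pass through a point of [c], so one of them holds two of [u], [v], [w]. If some
    set holds all three, it is that one; otherwise [cross_pair] applies to these two. *)
Lemma cross_intersecting_star (u v w : V) (c : seq V) :
    [&& u != v, u != w & v != w] -> uniq c -> 2 < size c ->
    (forall x, x \in c -> [&& x \notin [:: u; v; w], meets x u, meets x v & meets x w]) ->
  exists i, forall x, x \in c -> m i x.
Proof.
move=> /and3P[uv uw vw] Uc c2 cP.
have [/existsP[i /and3P[iu iv iw]]|/existsPn nc] :=
    boolP [exists k, [&& m k u, m k v & m k w]].
  exists i => x xc; apply/negPn/negP => nix.
  have /and4P[_ /existsP[p /andP[px pu]] /existsP[q /andP[qx qv]] /existsP[r /andP[rx rw]]] :=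
    cP x xc.
  have [ip iq ir] : [/\ i != p, i != q & i != r].
    by split; apply: contraNneq nix => ->.
  case/or3P: (m_le2 px qx rx) => /eqP E; subst.
  - by case/eqP: uv; apply: (m_inj iq).
  - by case/eqP: uw; apply: (m_inj ir).
  - by case/eqP: vw; apply: (m_inj ir).
have [x xc] : exists x, x \in c by case: c c2 {Uc cP} => // x c _; exists x; rewrite mem_head.
have /and4P[_ /existsP[p /andP[px pu]] /existsP[q /andP[qx qv]] /existsP[r /andP[rx rw]]] :=
  cP x xc.
case/or3P: (m_le2 px qx rx) => /eqP E; subst.
- by apply: (@cross_pair u v w) => //; exists x, q.
- apply: (@cross_pair u w v) => //; last by exists x, r.
    by move=> k; rewrite [m k w && _]andbC.
  move=> y /cP /and4P[ny -> -> ->]; rewrite !andbT.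
  by move: ny; rewrite !inE [(y == v) || _]orbC.
- apply: (@cross_pair v w u) => //; last by exists x, r.
    by move=> k; rewrite andbA andbC.
  move=> y /cP /and4P[ny -> -> ->]; rewrite !andbT.
  by apply: contra ny; rewrite !inE => /or3P[] ->; rewrite ?orbT.
Qed.

End CrossIntersecting.

(** * The glued graph *)

Section Gluing.

Variables (n : nat) (K : finType) (eK : rel K) (l : 'I_n -> K).
Hypotheses (eKG : is_graph eK) (l_inj : injective l).

(** For injective [l], the involution exchanging [l j] of copy [i] with [l i] of copy [j]; it fixes
    [(i, l i)] and all points off the image of [l]. *)
Definition twin (x : 'I_n * K) : 'I_n * K :=
  if [pick j | l j == x.2] is Some j then (j, l x.1) else x.

Definition glue_vertex : finType :=
  {A : {set 'I_n * K} | A \in [set [set x; twin x] | x in setT]}.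

Definition copy (i : 'I_n) (k : K) : glue_vertex :=
  exist _ [set (i, k); twin (i, k)] (imset_f _ (in_setT (i, k))).

Definition in_copy (i : 'I_n) : pred glue_vertex := [pred x | x \in codom (copy i)].

(** Joining all pairs without a common copy makes non-adjacency force a common copy. *)
Definition glue_edge : rel glue_vertex := fun x y =>
  [exists i, exists k, exists k', [&& x == copy i k, y == copy i k' & eK k k']]
  || ~~ meets in_copy x y.

Lemma twin_l i j : twin (i, l j) = (j, l i).
Proof. by rewrite /twin; case: pickP => [k /eqP /l_inj ->|/(_ j)] //=; rewrite eqxx. Qed.

Lemma copyP x : exists i k, x = copy i k.
Proof.
case: x => A AP; have /imsetP[[i k] _ E] := AP.
by exists i, k; apply: val_inj.
Qed.

Lemma copy_eq i k j k' : copy i k = copy j k' -> (j, k') = (i, k) \/ (j, k') = twin (i, k).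
Proof.
move/(congr1 val) => /= E; have : (j, k') \in [set (i, k); twin (i, k)].
  by rewrite E !inE eqxx.
by rewrite !inE => /orP[] /eqP; [left | right].
Qed.

Lemma copy_meet i j k k' : i != j -> copy i k = copy j k' -> k = l j /\ k' = l i.
Proof.
move=> ij /copy_eq[[ji]|]; first by rewrite ji eqxx in ij.
rewrite /twin /=; case: pickP => [h /eqP <- [-> ->]|_ [ji]] //.
by rewrite ji eqxx in ij.
Qed.

Lemma copy_inj i : injective (copy i).
Proof.
move=> k k' /copy_eq[[]|] //.
by rewrite /twin /=; case: pickP => [h /eqP <- [-> ->]|_ []].
Qed.

Lemma copy_glue i j : copy i (l j) = copy j (l i).
Proof.
apply: val_inj; rewrite /= !twin_l.
by apply/setP => x; rewrite !inE orbC.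
Qed.

Lemma in_copyP i x : reflect (exists k, x = copy i k) (in_copy i x).
Proof. exact: codomP. Qed.

Lemma in_copy_copy i k : in_copy i (copy i k).
Proof. exact: codom_f. Qed.

Lemma in_copy2 i j x : i != j -> in_copy i x -> in_copy j x -> x = copy i (l j).
Proof. by move=> ij /in_copyP[k ->] /in_copyP[k' /(copy_meet ij)[-> _]]. Qed.

Lemma in_copy_inj i j x y :
  i != j -> in_copy i x -> in_copy j x -> in_copy i y -> in_copy j y -> x = y.
Proof. by move=> ij ix jx iy jy; rewrite (in_copy2 ij ix jx) (in_copy2 ij iy jy). Qed.

Lemma in_copy_le2 x i j k :
  in_copy i x -> in_copy j x -> in_copy k x -> [|| i == j, i == k | j == k].
Proof.
move=> ix jx kx; have [//|ij] := eqVneq i j; have [//|ik] := eqVneq i k.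
have := in_copy2 ij ix jx; rewrite (in_copy2 ik ix kx) => /copy_inj /l_inj ->.
exact: eqxx.
Qed.

(** Copies are induced: another copy shares at most one vertex with copy [i], and [eK] has no loops,
    so it adds no edge inside copy [i]. *)
Lemma glue_edge_copy i k k' : eK k k' = glue_edge (copy i k) (copy i k').
Proof.
have mt : meets in_copy (copy i k) (copy i k').
  by apply/existsP; exists i; rewrite !in_copy_copy.
rewrite /glue_edge mt orbF; apply/idP/existsP.
  by move=> ekk'; exists i; apply/existsP; exists k; apply/existsP; exists k'; rewrite !eqxx.
move=> [j /existsP[h /existsP[h' /and3P[/eqP E /eqP E' ehh']]]].
have [ij|ij] := eqVneq i j.
  by subst j; rewrite (copy_inj E) (copy_inj E').
have [_ eh] := copy_meet ij E; have [_ eh'] := copy_meet ij E'.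
by case: eKG => _ irr; rewrite eh eh' irr in ehh'.
Qed.

Lemma glue_edge_graph : is_graph glue_edge.
Proof.
have [Ksym Kirr] := eKG; split.
  move=> x y; rewrite /glue_edge; congr (_ || ~~ _); last first.
    by apply: eq_existsb => i; rewrite andbC.
  apply: eq_existsb => i; apply/existsP/existsP;
  by move=> [k /existsP[k' /and3P[xk yk E]]]; exists k'; apply/existsP; exists k;
    rewrite xk yk Ksym.
by move=> x; have [i [k ->]] := copyP x; rewrite -glue_edge_copy Kirr.
Qed.

Lemma nonadjacent_meets x y : ~~ glue_edge x y -> meets in_copy x y.
Proof. by apply: contraR => nm; apply/orP; right. Qed.

(** Each of [u], [v], [w], being non-adjacent to the cycle, shares a copy with each of its vertices,
    so [cross_intersecting_star] applies. *)
Lemma far_cycle_in_copy c u v w :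
    is_cycle glue_edge c -> [&& u != v, u != w & v != w] ->
    (forall z, z \in [:: u; v; w] -> forall x, x \in c -> (x != z) && ~~ glue_edge z x) ->
  exists i, forall x, x \in c -> in_copy i x.
Proof.
move=> /and3P[Uc c2 _] duvw far.
apply: (cross_intersecting_star in_copy_le2 in_copy_inj duvw Uc c2) => x xc.
have mt z : z \in [:: u; v; w] -> (x != z) && meets in_copy x z.
  have [glue_sym _] := glue_edge_graph.
  move=> zuvw; have /andP[-> nzx] := far z zuvw x xc.
  by apply: nonadjacent_meets; rewrite glue_sym.
rewrite !inE !negb_or.
have /andP[-> ->] := mt u (mem_head _ _).
have [|-> ->] := andP (mt v _); first by rewrite !inE eqxx orbT.
by have [|-> ->] := andP (mt w _); first by rewrite !inE eqxx !orbT.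
Qed.

Lemma in_copy_cycle i c :
  is_cycle glue_edge c -> (forall x, x \in c -> in_copy i x) ->
  exists2 c', c = map (copy i) c' & is_cycle eK c'.
Proof.
move=> cc ci; have [c' defc] : exists c', c = map (copy i) c'.
  elim: c {cc} ci => [|x c IH] ci; first by exists [::].
  have [k ->] := in_copyP i x (ci x (mem_head _ _)).
  have [y yc|c' ->] := IH; first by apply: ci; rewrite inE yc orbT.
  by exists (k :: c').
by exists c' => //; rewrite -(is_cycle_map c' (@copy_inj i) (@glue_edge_copy i)) -defc.
Qed.

(* A vertex outside copy [i] shares a copy with at most two vertices of copy [i]. *)
Lemma in_copy_nonneighbours i y (X : {set glue_vertex}) :
  ~~ in_copy i y -> (forall x, x \in X -> in_copy i x && ~~ glue_edge y x) -> #|X| <= 2.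
Proof.
move=> niy XP; rewrite leqNgt; apply/negP => /card_gt2P.
move=> [x1 [x2 [x3 [[X1 X2 X3] [n12 n23 n31]]]]].
have get x : x \in X -> exists j, [/\ i != j, in_copy j y, in_copy i x & in_copy j x].
  move=> /XP/andP[ix /nonadjacent_meets/existsP[j /andP[jy jx]]]; exists j; split=> //.
  by apply: contraNneq niy => ->.
have [j1 [d1 y1 i1 m1]] := get _ X1; have [j2 [d2 y2 i2 m2]] := get _ X2.
have [j3 [d3 y3 i3 m3]] := get _ X3.
case/or3P: (in_copy_le2 y1 y2 y3) => /eqP E; subst.
- by rewrite (in_copy_inj d2 i1 m1 i2 m2) eqxx in n12.
- by rewrite (in_copy_inj d3 i1 m1 i3 m3) eqxx in n31.
- by rewrite (in_copy_inj d3 i2 m2 i3 m3) eqxx in n23.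
Qed.

(** Double counting of incidences between [X] and the copies: each copy has at least one, each
    vertex at most two. *)
Lemma card_in_copy (X : {set glue_vertex}) :
  (forall i, exists2 x, x \in X & in_copy i x) -> n <= #|X|.*2.
Proof.
move=> XP; have -> : #|X|.*2 = \sum_(x in X) 2 by rewrite sum_nat_const muln2.
have {1}-> : n = \sum_(i < n) 1 by rewrite sum1_card card_ord.
apply: (@leq_trans (\sum_(i < n) \sum_(x in X) in_copy i x)).
  apply: leq_sum => i _; have [x xX ix] := XP i.
  by rewrite (bigD1 x) //= [X in X + _]/(nat_of_bool (in_copy i x)) ix.
rewrite exchange_big; apply: leq_sum => x _ /=.
rewrite -big_mkcond /= sum1_card leqNgt; apply/negP => /card_gt2P.
move=> [i [j [k [[ix jx kx] [ij jk ki]]]]].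
move: (in_copy_le2 ix jx kx).
by rewrite (negPf ij) (negPf jk) eq_sym (negPf ki).
Qed.

End Gluing.

(* Vertices outside the copy carrying the far cycle would have a degree larger
   than any degree of [e], so the subdivision lives in one copy and fills it. *)
Lemma glue_induced_subdiv (T : finType) (e : rel T) (n : nat) (K : finType)
    (eK : rel K) (l : 'I_n -> K) d (A : {set glue_vertex l}) :
    is_graph e -> far_cycle e -> 1 < d -> max_degree_le e d ->
    is_graph eK -> injective l ->
    (forall c, is_cycle eK c -> d.+2 < size c) ->
    (forall B : {set K}, induced_subdiv e eK B -> B = setT) ->
    induced_subdiv e (glue_edge eK (l := l)) A ->
  exists i, A = [set copy l i k | k in setT].
Proof.
move=> eG efar d1 ed eKG l_inj girth Kmin eA.
have [c [u [v [w [cc duvw far]]]]] := subdivision_far_cycle eG efar eA.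
have cc' : is_cycle (glue_edge eK (l := l)) (map val c).
  by rewrite (is_cycle_map (e := @induced _ (glue_edge eK (l := l)) A) c val_inj).
have [i ci] : exists i, forall x, x \in map val c -> in_copy i x.
  apply: (@far_cycle_in_copy _ _ _ _ eKG l_inj _ (val u) (val v) (val w)) => //.
  move=> z' z'uvw _ /mapP[x xc ->].
  have /mapP[z zuvw ->] : z' \in map val [:: u; v; w] by [].
  exact: far.
have dc : d.+2 < size c.
  have [c' defc cK] := in_copy_cycle eKG cc' ci.
  by rewrite -(size_map val) defc size_map girth.
have Ai y : y \in A -> in_copy i y.
  move=> yA; apply: contraLR dc => niy; rewrite -leqNgt.
  have /and3P[Uc _ _] := cc.
  rewrite -(card_uniqP Uc) -(cardsE (mem c)).
  pose N := [set x | @induced _ (glue_edge eK (l := l)) A (exist _ y yA) x].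
  (* At most [d] vertices of the cycle are adjacent to [y], by the degree bound in the subdivision,
     and at most two are not. *)
  rewrite -(cardsID N) -addn2; apply: leq_add.
    apply: leq_trans (subdivision_degree eG d1 ed eA (exist _ y yA)).
    exact/subset_leq_card/subsetIr.
  rewrite -(card_imset _ val_inj).
  apply: (@in_copy_nonneighbours _ _ eK l l_inj i y) => // x /imsetP[x' ].
  rewrite !inE /induced /= => /andP[nyx x'c] ->; rewrite nyx andbT.
  by apply: ci; apply: map_f.
exists i.
have defA : A = copy l i @: (copy l i @^-1: A).
  apply/setP => y; apply/idP/imsetP => [yA|[k]]; last by rewrite inE => kA ->.
  have [k defy] := in_copyP i y (Ai y yA); exists k => //.
  by rewrite inE -defy.
(* Pulled back to [K], [A] is still a subdivision, so by minimality it fills [K]. *)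
rewrite {1}defA (Kmin (copy l i @^-1: A)) //; apply: subdivision_iso eA _.
by apply: graph_iso_sym; apply: induced_iso (@copy_inj _ _ _ i) (glue_edge_copy l eKG i) defA.
Qed.

(** * Refuting the property at [k = 2] *)

Theorem mainTheorem6 (TH : finType) (eH : rel TH) (Hgraph : is_graph eH)
  (c : seq TH) (Hc : [&& uniq c, 2 < size c & cycle eH c])
  (u v w : TH) (Huvw : [&& u != v, u != w & v != w])
  (Hnb : forall x, x \in c -> [&& ~~ eH u x, ~~ eH v x & ~~ eH w x]) :
  ~ induced_EP eH.
Proof.
move=> [f EP].
have Hfar : far_cycle eH.
  exists c, u, v, w; split=> // z zuvw.
  have nz x : x \in c -> ~~ eH z x.
    by case/Hnb/and3P=> nu nv nw; move: zuvw; rewrite !inE => /or3P[] /eqP ->.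
  (* A vertex on the cycle has its successor as a neighbour there, so [z] is off it. *)
  move=> x xc; rewrite nz // andbT; apply: contraTneq xc => ->.
  apply/negP => zc; have /and3P[_ _ cc] := Hc.
  have := nz (next c z); rewrite mem_next zc => /(_ isT).
  by rewrite (next_cycle cc zc).
(* [n] exceeds twice the supposed bound [f 2]; [d] bounds the degrees crudely, and the added 2
   ensures [1 < d]. *)
pose n := (f 2).*2.+1; pose d := #|TH|.+2.
have Hd : max_degree_le eH d by move=> x; apply: leq_trans (max_card _) (leqW (leqnSn _)).
(* Girth [n] provides enough vertices to glue along; [d.+3] beats the [d + 2] count in
   [glue_induced_subdiv]. *)
have [K [eK [HK girth Kmin]]] := subdivision_girth_minimal (maxn n d.+3) Hgraph.
have eKG := subdivision_graph Hgraph HK.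
have [cK [_ [_ [_ [ccK _ _]]]]] := subdivision_far_cycle Hgraph Hfar HK.
have scK := girth _ ccK; have /and3P[UcK cK2 _] := ccK.
have [k0 _] : exists k0 : K, True by case: cK cK2 {scK UcK ccK} => // k0; exists k0.
pose l (i : 'I_n) := nth k0 cK i.
have lt_l (i : 'I_n) : i < size cK by apply: leq_trans (ltn_ord i) (leq_trans (leq_maxl _ _) scK).
have l_inj : injective l.
  by move=> i j /eqP; rewrite nth_uniq // => /eqP; apply: val_inj.
have star (A : {set glue_vertex l}) := @glue_induced_subdiv _ _ _ _ _ l d A
  Hgraph Hfar isT Hd eKG l_inj (fun c' cc => leq_trans (leq_maxr _ _) (girth c' cc)) Kmin.
case: (EP _ _ (glue_edge_graph l eKG) 2 isT) => [[P [HP dis]]|[X [sX hit]]].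
  (* Disjoint subdivisions would both be copies, yet [copy l i (l j)] lies in each. *)
  have [i Pi] := star _ (HP ord0); have [j Pj] := star _ (HP ord_max).
  have xi : copy l i (l j) \in P ord0 by rewrite Pi imset_f.
  have xj : copy l i (l j) \in P ord_max by rewrite Pj (copy_glue l_inj) imset_f.
  by have := disjointFr (dis ord0 ord_max isT) xi; rewrite xj.
(* Every copy is an induced subdivision of [H], so [X] meets all [n] copies and is larger than
   [f 2]. *)
suff : n <= #|X|.*2 by rewrite /n ltnNge leq_double sX.
apply: card_in_copy => // i.
have : ~~ [disjoint [set copy l i k | k in setT] & X].
  apply: hit; apply: subdivision_iso HK _.
  apply: graph_iso_trans (induced_setT_iso _) _.
  exact: induced_iso (@copy_inj _ _ _ i) (glue_edge_copy l eKG i) (erefl _).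
case/pred0Pn=> x /= /andP[/imsetP[k _ ->] kX].
by exists (copy l i k) => //; apply: in_copy_copy.
Qed.
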